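(* Let $\alpha_1,\alpha_2,\alpha_3\in\mathbb R^{4}$ be vectors representing (in homogeneous coordinates) planes $\pi_1,\pi_2,\pi_3$ respectively, located in general position, i.e. with $\alpha_1,\alpha_2,\alpha_3$ linearly independent. Let $\mathbf x\in\mathbb R^{4}$ be a nonzero vector representing a point in homogeneous coordinates, and let $\mathcal A=\alpha_1\wedge\alpha_2\wedge\alpha_3$, a third-order $4$-dimensional tensor. Then the three planes meet at the unique point $\mathbf x$ if and only if $\mathcal A\mathbf x=0$.
   Context: Points and planes of projective 3-space are represented by nonzero vectors of $\mathbb R^4$ up to nonzero scalar; the point $\mathbf x$ lies on the plane represented by $\alpha$ iff $\alpha^{\top}\mathbf x=0$. Uniqueness of a point is as a projective point (up to nonzero scalar). For $\mathbf v_1,\mathbf v_2,\mathbf v_3\in\mathbb R^4$, $\mathbf v_1\times\mathbf v_2\times\mathbf v_3$ is the tensor with $(i,j,k)$-entry $(\mathbf v_1)_i(\mathbf v_2)_j(\mathbf v_3)_k$, and $\mathbf v_1\wedge\mathbf v_2\wedge\mathbf v_3=\sum_{\sigma}\operatorname{sgn}(\sigma)\,\mathbf v_{\sigma(1)}\times\mathbf v_{\sigma(2)}\times\mathbf v_{\sigma(3)}$, the sum over all permutations of $\{1,2,3\}$. The product $\mathcal A\mathbf x$ is the contraction along the last mode: $(\mathcal A\mathbf x)_{ij}=\sum_{k=1}^4 A_{ijk}x_k$. *)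

(* Defs.v *)
From mathcomp Require Import all_boot all_order all_algebra all_fingroup.
From mathcomp Require Import reals.
Set Implicit Arguments.
Unset Strict Implicit.
Unset Printing Implicit Defensive.
Import Order.TTheory GRing.Theory Num.Theory.
Local Open Scope ring_scope.

(* The codomain is R^o (convertible to R) so that tensors inherit the
   R-module structure of finite functions. *)
Notation tensor3 R n := {ffun 'I_n * 'I_n * 'I_n -> R^o}.

Definition outer3 (R : realType) (n : nat) (v1 v2 v3 : 'cV[R]_n) :
    tensor3 R n :=
  [ffun p : 'I_n * 'I_n * 'I_n => v1 p.1.1 0 * v2 p.1.2 0 * v3 p.2 0].

(* Indices of the three vectors are shifted to 0, 1, 2; (-1) ^+ s is sgn s,
   through the parity coercion from permutations to bool. *)
Definition wedge3 (R : realType) (n : nat) (v1 v2 v3 : 'cV[R]_n) :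
    tensor3 R n :=
  let v := tnth [tuple v1; v2; v3] in
  \sum_(s : 'S_3) (-1) ^+ s *:
    outer3 (v (s (inord 0))) (v (s (inord 1))) (v (s (inord 2))).

Definition contract_last (R : realType) (n : nat) (A : tensor3 R n)
    (x : 'cV[R]_n) : 'M[R]_n :=
  \matrix_(i, j) \sum_(k < n) A (i, j, k) * x k 0.

Definition on_plane (R : realType) (a x : 'cV[R]_4) : Prop := a^T *m x = 0.

Definition same_point (R : realType) (x y : 'cV[R]_4) : Prop :=
  exists2 c : R, c != 0 & y = c *: x.

Definition on_planes (R : realType) (a1 a2 a3 x : 'cV[R]_4) : Prop :=
  [/\ on_plane a1 x, on_plane a2 x & on_plane a3 x].

(* Homogeneous coordinates: only nonzero y represent points. *)
Definition meet_at_unique_point (R : realType) (a1 a2 a3 x : 'cV[R]_4) :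
    Prop :=
  on_planes a1 a2 a3 x /\
  forall y : 'cV[R]_4, y != 0 -> on_planes a1 a2 a3 y -> same_point x y.

(* Main.v *)
Require Import Defs.
From mathcomp Require Import all_boot all_order all_algebra all_fingroup.
From mathcomp Require Import reals ring.
Set Implicit Arguments.
Unset Strict Implicit.
Unset Printing Implicit Defensive.
Import Order.TTheory GRing.Theory Num.Theory.
Local Open Scope ring_scope.

(** Write [c_i = alpha_i^T x].  Contracting the last slot of the wedge product
    against [x] gives the combination
    [c_1 (alpha_2 /\ alpha_3) + c_2 (alpha_3 /\ alpha_1)
     + c_3 (alpha_1 /\ alpha_2)]
    of antisymmetric matrices ([contract_last_wedge3]).  The three matrices
    are linearly independent when the [alpha_i] are, so the contraction
    vanishes exactly when every [c_i] does, that is, when [x] lies on the three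
    planes ([contract_last_wedge3_eq0]).

    Uniqueness of the intersection point then comes for free: three independent
    linear forms on a space of dimension 4 have a common kernel of dimension 1,
    so any two nonzero vectors of it are proportional
    ([on_planes_same_point]). *)

(** The signed sum over ['S_3] is the Leibniz formula; recognizing a
    determinant lets Laplace expansion enumerate the six permutations. *)
Lemma wedge3_det (R : realType) (n : nat) (u v w : 'cV[R]_n) (i j k : 'I_n) :
  wedge3 u v w (i, j, k) =
  \det (\matrix_(r < 3, c < 3)
          tnth [tuple u; v; w] c (tnth [tuple i; j; k] r) 0).
Proof.
rewrite /wedge3 sum_ffunE; apply: eq_bigr => s _.
rewrite !ffunE /= !big_ord_recl big_ord0 mulr1 !mxE /=.
have E0 : inord 0 = ord0 :> 'I_3 by apply: val_inj; rewrite /= inordK.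
have E1 : inord 1 = lift ord0 ord0 :> 'I_3 by apply: val_inj; rewrite /= inordK.
have E2 : inord 2 = lift ord0 (lift ord0 ord0) :> 'I_3.
  by apply: val_inj; rewrite /= inordK.
by rewrite E0 E1 E2 -[in LHS]mulrA.
Qed.

Lemma wedge3E (R : realType) (n : nat) (u v w : 'cV[R]_n) (i j k : 'I_n) :
  wedge3 u v w (i, j, k) =
    u i 0 * (v j 0 * w k 0 - w j 0 * v k 0)
  + v i 0 * (w j 0 * u k 0 - u j 0 * w k 0)
  + w i 0 * (u j 0 * v k 0 - v j 0 * u k 0).
Proof.
rewrite wedge3_det (expand_det_row _ ord0) !big_ord_recl big_ord0 /cofactor.
rewrite !(expand_det_row _ ord0) !big_ord_recl !big_ord0 /cofactor !det_mx11.
rewrite !mxE /= !(tnth_nth 0) !(tnth_nth i) /= /bump /=.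
ring.
Qed.

Lemma contract_last_wedge3 (R : realType) (n : nat) (u v w x : 'cV[R]_n) :
  contract_last (wedge3 u v w) x =
    (u^T *m x) 0 0 *: (v *m w^T - w *m v^T)
  + (v^T *m x) 0 0 *: (w *m u^T - u *m w^T)
  + (w^T *m x) 0 0 *: (u *m v^T - v *m u^T).
Proof.
apply/matrixP => i j; rewrite !mxE !big_ord1 !mxE !mulr_suml -!big_split /=.
by apply: eq_bigr => k _; rewrite wedge3E !mxE; ring.
Qed.

Lemma free3_eq0 (R : fieldType) (V : vectType R) (u v w : V) (a b c : R) :
  free [:: u; v; w] -> a *: u + b *: v + c *: w = 0 ->
  [/\ a = 0, b = 0 & c = 0].
Proof.
move=> /(@freeP _ _ _ [tuple u; v; w]) fr abc0.
have k0 := fr (fun i => nth 0 [:: a; b; c] i).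
have {}k0 : forall i : 'I_3, nth 0 [:: a; b; c] i = 0.
  by apply: k0; rewrite !big_ord_recl big_ord0 /= addr0 addrA.
split; first exact: (k0 ord0); first exact: (k0 (lift ord0 ord0)).
exact: (k0 (lift ord0 (lift ord0 ord0))).
Qed.

(** With [c_u = u^T x] and so on, column [j] of the contraction is a linear
    combination of [u, v, w] whose coefficients are the [j]-th entries of
    [c_w v - c_v w], [c_u w - c_w u] and [c_v u - c_u v].  Independence kills
    these three vectors, and then, applied to two of them, the [c]s. *)
Lemma contract_last_wedge3_eq0 (R : realType) (n : nat) (u v w x : 'cV[R]_n) :
  free [:: u; v; w] ->
  contract_last (wedge3 u v w) x = 0 <->
  [/\ u^T *m x = 0, v^T *m x = 0 & w^T *m x = 0].
Proof.
move=> fr; rewrite contract_last_wedge3; split; last first.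
  by case=> -> -> ->; rewrite !mxE !scale0r !addr0.
move: (u^T *m x) (v^T *m x) (w^T *m x) => cu cv cw ctr0.
have coef0 j :
    [/\ cw 0 0 * v j 0 - cv 0 0 * w j 0 = 0,
        cu 0 0 * w j 0 - cw 0 0 * u j 0 = 0
      & cv 0 0 * u j 0 - cu 0 0 * v j 0 = 0].
  apply: (free3_eq0 fr); apply/colP => i.
  have /matrixP/(_ i j) := ctr0.
  rewrite !mxE !big_ord1 !mxE => ctr0ij.
  by rewrite -[RHS]ctr0ij; ring.
have [_ cw0 /eqP] : [/\ (0 : R) = 0, cw 0 0 = 0 & - cv 0 0 = 0].
  apply: (free3_eq0 fr); apply/colP => j; have [cwv _ _] := coef0 j.
  by rewrite !mxE mul0r add0r mulNr.
rewrite oppr_eq0 => /eqP cv0.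
have [_ _ cu0] : [/\ - cw 0 0 = 0, (0 : R) = 0 & cu 0 0 = 0].
  apply: (free3_eq0 fr); apply/colP => j; have [_ cuw _] := coef0 j.
  by rewrite !mxE mul0r addr0 mulNr addrC.
by split; apply/matrixP => k l; rewrite !ord1 mxE.
Qed.

(** The row vectors annihilated by the 4 x 3 matrix [A] of the planes form a
    space of dimension [4 - 3 = 1], so [x^T], being nonzero, spans it. *)
Lemma on_planes_same_point (R : realType) (a1 a2 a3 x y : 'cV[R]_4) :
  free [:: a1; a2; a3] -> x != 0 -> y != 0 ->
  on_planes a1 a2 a3 x -> on_planes a1 a2 a3 y -> same_point x y.
Proof.
move=> fr x_neq0 y_neq0 onx ony.
pose A := row_mx a1 (row_mx a2 a3).
have in_ker z : on_planes a1 a2 a3 z -> (z^T <= kermx A)%MS.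
  case=> z1 z2 z3; apply/sub_kermxP; apply: trmx_inj.
  by rewrite trmx_mul trmxK !tr_row_mx !mul_col_mx z1 z2 z3 !col_mx0 trmx0.
have rankA : \rank A = 3.
  rewrite -mxrank_tr; apply/eqP; apply: inj_row_free => r.
  rewrite -[r]hsubmxK -[rsubmx r]hsubmxK !tr_row_mx !mul_row_col.
  move: (lsubmx r) (lsubmx (rsubmx r)) (rsubmx (rsubmx r)) => a b c.
  rewrite [a]mx11_scalar [b]mx11_scalar [c]mx11_scalar !mul_scalar_mx addrA.
  move=> /(congr1 trmx); rewrite !linearD !linearZ /= !trmxK trmx0.
  by move=> /(free3_eq0 fr)[-> -> ->]; rewrite !raddf0 !row_mx0.
have kerA : (kermx A <= x^T)%MS.
  have := mxrank_leqif_sup (in_ker x onx).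
  rewrite mxrank_ker rankA rank_rV trmx_eq0 x_neq0.
  by case=> _ <-.
have /sub_rVP[c yE] := submx_trans (in_ker y ony) kerA.
have {}yE : y = c *: x by apply: trmx_inj; rewrite yE linearZ.
exists c => //; apply: contraNneq y_neq0 => c0.
by rewrite yE c0 scale0r.
Qed.

Theorem theorem3p2 (R : realType) (alpha1 alpha2 alpha3 : 'cV[R]_4)
    (x : 'cV[R]_4)
    (general_position : free [:: alpha1; alpha2; alpha3])
    (x_neq0 : x != 0) :
  meet_at_unique_point alpha1 alpha2 alpha3 x <->
  contract_last (wedge3 alpha1 alpha2 alpha3) x = 0.
Proof.
rewrite contract_last_wedge3_eq0 //; split=> [[] // | onx].
split=> // y y_neq0 ony.
exact: (on_planes_same_point general_position).
Qed.
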